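(* Let $k\ge 1$, $n\ge 1$, $m=kn+1$, and let $D\in\mathcal D_{m,n}$. Let $\overline D=\Phi^{-1}(D)$, let $r_1<r_2<\dots<r_{m+n}$ be the ranks of the vertices of $\overline D$ other than its final vertex $(m,n)$, and form the word $\mathrm{EN}(D)=x_1x_2\cdots x_{m+n}$ in the letters $N,E$ by letting $x_i=N$ if the step of $\overline D$ that ends at the vertex of rank $r_i$ is a North step and $x_i=E$ if it is an East step (the vertex of rank $0$ being regarded as the endpoint $(m,n)$ of the last step). Let $b_1<\dots<b_n$ be the entries of the bottom row (row $k+1$) of the tableau $T(D)$. Then $x_i=N$ if and only if $i\in\{b_1+1,\dots,b_n+1\}$; all other $m$ letters are $E$.
   Context: Let $m,n$ be coprime positive integers. $\mathcal D_{m,n}$ is the set of lattice paths from $(0,0)$ to $(m,n)$ with unit North steps $(0,1)$ and East steps $(1,0)$ staying weakly above the segment from $(0,0)$ to $(m,n)$. The rank of a lattice point $(x,y)$ is $ym-xn$ (a North step adds $m$, an East step subtracts $n$); the $m+n$ vertices of a path other than its endpoint have distinct nonnegative ranks, and the endpoint has rank $0$. The step word $\mathrm{SW}(P)$ of a path $P$ is the word of length $m+n$ whose $i$-th letter is $S$ if the $i$-th step is North and $W$ if it is East. The sweep map $\Phi:\mathcal D_{m,n}\to\mathcal D_{m,n}$ sends $P$ to the path whose $i$-th step is North iff the step of $P$ with the $i$-th smallest starting-vertex rank is North; $\Phi$ is a bijection of $\mathcal D_{m,n}$ when $m=kn+1$. Filling algorithm (for $m=kn+1$): given $D\in\mathcal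 D_{m,n}$, $T(D)$ is the array with $k+1$ rows and $n$ columns built by reading the first $m+n-1$ letters of $\mathrm{SW}(D)$: place $1$ at the top of column $1$; for $i=2,\dots,m+n-1$, if the $i$-th letter is $S$ place $i$ at the top of the leftmost empty column, and if it is $W$ place $i$ immediately below the smallest active entry, where an entry is active if it is currently the lowest entry of its column and is not in row $k+1$. The result is a standard Young tableau of rectangular shape with entries $1,\dots,(k+1)n$. *)

(* Defs.v *)
From HB Require Import structures.
From mathcomp Require Import all_boot all_order all_algebra.
Set Implicit Arguments.
Unset Strict Implicit.
Unset Printing Implicit Defensive.

Inductive step := North | East.

Definition step_eqb (s t : step) : bool :=
  match s, t with North, North | East, East => true | _, _ => false end.

Lemma step_eqP : Equality.axiom step_eqb.
Proof. by case; case; constructor. Qed.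

HB.instance Definition _ := hasDecEq.Build step step_eqP.

Inductive letter := LetterS | LetterW.

(* A lattice path starting at (0, 0) is the sequence of its steps; its vertices
   are numbered 0, ..., size P, so that step number i (from 0) goes from
   vertex i to vertex i + 1. *)
Definition vertex (P : seq step) (i : nat) : nat * nat :=
  (count_mem East (take i P), count_mem North (take i P)).

Definition rank (m n : nat) (v : nat * nat) : int :=
  ((v.2 * m)%:Z - (v.1 * n)%:Z)%R.

(* A lattice path stays weakly above the segment from (0, 0) to (m, n) as soon
   as its vertices do; (x, y) is weakly above it when x n <= y m. *)
Definition dyck (m n : nat) (P : seq step) : bool :=
  (vertex P (size P) == (m, n)) &&
  all (fun i => (vertex P i).1 * n <= (vertex P i).2 * m) (iota 0 (size P).+1).

(* The indices of the vertices other than the last one, listed by increasing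
   rank. *)
Definition rank_order (m n : nat) (P : seq step) : seq nat :=
  sort (fun i j => (rank m n (vertex P i) <= rank m n (vertex P j))%R)
    (iota 0 (size P)).

Definition sweep (m n : nat) (P : seq step) : seq step :=
  [seq nth East P i | i <- rank_order m n P].

(* The step ending at vertex i; vertex 0 is identified with the endpoint. *)
Definition step_into (P : seq step) (i : nat) : step :=
  if i is j.+1 then nth East P j else last East P.

(* EN(D) for D = sweep P. *)
Definition EN (m n : nat) (P : seq step) : seq step :=
  [seq step_into P i | i <- rank_order m n P].

Definition SW (P : seq step) : seq letter :=
  [seq if s is North then LetterS else LetterW | s <- P].

(* Arrays are sequences of columns, each column being the sequence of its
   entries from top to bottom. *)
Definition array := seq (seq nat).

Definition has_active (k : nat) (c : seq nat) : bool := 0 < size c < k.+1.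

Definition active_entries (k : nat) (T : array) : seq nat :=
  [seq last 0 c | c <- T & has_active k c].

Definition smallest_active (k : nat) (T : array) : nat :=
  head 0 (sort leq (active_entries k T)).

(* Entries are pairwise distinct, so a W letter extends only one column. On the
   words of the paths in [dyck], an S letter always finds an empty column. *)
Definition place (k : nat) (T : array) (l : letter) (i : nat) : array :=
  match l with
  | LetterS => set_nth [::] T (index [::] T) [:: i]
  | LetterW =>
      [seq if has_active k c && (last 0 c == smallest_active k T)
           then rcons c i else c | c <- T]
  end.

(* [index_iota 2 (m + n)] is 2, ..., m + n - 1; letters are numbered from 1. *)
Definition tableau (k n : nat) (D : seq step) : array :=
  let m := k * n + 1 in
  foldl (fun T i => place k T (nth LetterW (SW D) i.-1) i)
    ([:: 1] :: nseq n.-1 [::]) (index_iota 2 (m + n)).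

Definition bottom_row (k : nat) (T : array) : seq nat :=
  pmap (fun c => onth c k) T.

(* Main.v *)
Require Import Defs.
From mathcomp Require Import all_boot all_order all_algebra.
From mathcomp Require Import zify.
Set Implicit Arguments.
Unset Strict Implicit.
Unset Printing Implicit Defensive.

(** Let V be the set of ranks of the vertices of the preimage path, and let S be
    the set of ranks from which a North step starts.  As the rank is congruent
    to the height modulo n, S has one element in each residue class.  Let R be
    the "grid" of the numbers e + t n with e in S and 0 <= t <= k.

    Adding n is an increasing bijection from the non-bottom to the non-top
    elements of R, which is the first-in first-out rule of the filling
    algorithm.  So the tableau is the standardization of R, as soon as each e in
    S has the same position in R as in V.

    A telescoping sum along the cyclic path shows that the numbers of elements
    <= z of V and of R differ by the number of e in S with e + (k + 1) n <= z and
    e = z modulo n.  This vanishes at z = e + t n for e in S and t <= k.  The case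
    t = 0 is the requirement above.  With t = k it says that the bottom entry of
    the column of e is the number of ranks below e + k n + 1 = e + m, the rank at
    which the North step starting at e ends. *)

(** * Positions in a sequence, expressed by counting the elements up to a bound *)

(** If z' < z, then z itself is counted for z but not for z', so the count strictly drops. *)
Lemma leq_count_le (s : seq nat) (z z' : nat) : z \in s ->
  (count (leq^~ z) s <= count (leq^~ z') s) = (z <= z').
Proof.
move=> zs; case: (leqP z z') => [lezz'|ltz'z].
  by apply: sub_count => y /= /leq_trans; apply.
apply/negbTE; rewrite -ltnNge.
elim: s zs => //= y s IH; rewrite inE => /orP[/eqP <-|/IH H].
  rewrite leqnn (leqNgt z z') ltz'z /= add0n add1n ltnS.
  by apply: sub_count => x /= lexz'; apply: leq_trans lexz' (ltnW _).
case: (leqP y z') => [leyz'|_]; last by rewrite add0n (leq_trans H) ?leq_addl.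
by rewrite (leq_trans leyz' (ltnW ltz'z)) !add1n ltnS.
Qed.

Lemma count_le_inj (s : seq nat) : {in s &, injective (fun z => count (leq^~ z) s)}.
Proof.
by move=> z z' zs z's eqzz'; apply/eqP; rewrite eqn_leq -(leq_count_le z' zs) -(leq_count_le z z's) eqzz' leqnn.
Qed.

Lemma sorted_count_le_nth (s : seq nat) (i : nat) : sorted ltn s -> i < size s ->
  count (leq^~ (nth 0 s i)) s = i.+1.
Proof.
move=> ss lti; rewrite -(size_takel lti) -(@Order.POrderTheory.filter_le_nth _ _ 0) //.
  by rewrite size_filter.
Qed.

Lemma count_le_surj (s : seq nat) (i : nat) : uniq s -> 0 < i <= size s ->
  exists2 z, z \in s & count (leq^~ z) s = i.
Proof.
case: i => // i us /= lti.
have ss : sorted ltn (sort leq s).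
  by rewrite ltn_sorted_uniq_leq sort_uniq us sort_sorted //; apply: leq_total.
exists (nth 0 (sort leq s) i); first by rewrite -(mem_sort leq) mem_nth // size_sort.
by rewrite -(permP (permEl (perm_sort leq s))) sorted_count_le_nth ?size_sort.
Qed.

(** One step of the filling, seen in a single column: the new label can only go below those already
    there. *)
Lemma filter_leS_sorted (s : seq nat) (i : nat) : sorted ltn s ->
  [seq x <- s | x <= i.+1] =
  if i.+1 \in s then rcons [seq x <- s | x <= i] i.+1 else [seq x <- s | x <= i].
Proof.
elim: s => // x s IH /= sxs; have /IH {}IH := path_sorted sxs.
have xs : all (ltn x) s by apply: order_path_min sxs; apply: ltn_trans.
rewrite inE IH; case: eqVneq => [xi|neq] /=.
  subst x; rewrite leqnn ltnn.
  have nis : i.+1 \notin s by apply/negP => /(allP xs) /=; rewrite ltnn.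
  rewrite (negbTE nis); suff -> : [seq x <- s | x <= i] = [::] by [].
  apply/eqP; rewrite -size_eq0 size_filter -leqn0 leqNgt -has_count.
  by apply/hasPn => y /(allP xs) /=; lia.
have -> : (x <= i.+1) = (x <= i) by lia.
by case: ifP => _; case: ifP.
Qed.

Lemma head_sort_min (s : seq nat) (x : nat) :
  x \in s -> (forall y, y \in s -> x <= y) -> head 0 (sort leq s) = x.
Proof.
move=> xs minx; have: sorted leq (sort leq s) by apply/sort_sorted/leq_total.
have := mem_sort leq s; case: (sort leq s) => [/(_ x)|y t mem_yt /= pt].
  by rewrite xs in_nil.
apply/eqP; rewrite eqn_leq minx -?mem_yt ?mem_head // andbT.
move: xs; rewrite -mem_yt inE => /orP[/eqP -> //|xt].
by have /allP/(_ _ xt) := order_path_min leq_trans pt.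
Qed.

Lemma set_nth_cat_size (T : Type) (x0 x y : T) (s1 s2 : seq T) :
  set_nth x0 (s1 ++ x :: s2) (size s1) y = s1 ++ y :: s2.
Proof. by elim: s1 => //= z s1 ->. Qed.

(** * The filling algorithm as the standardization of a grid *)

Section Filling.

Variables (k n : nat) (es : seq nat).
Hypothesis n_gt0 : 0 < n.
Hypothesis size_es : size es = n.
Hypothesis sorted_es : sorted ltn es.
Hypothesis es_mod : {in es &, forall e e', e = e' %[mod n] -> e = e'}.

Definition grid := [seq e + t * n | e <- es, t <- iota 0 k.+1].
(** On grid elements this is the label, starting from 1, given by standardization. *)
Definition grid_pos (z : nat) := count (leq^~ z) grid.
Definition grid_col (e : nat) := [seq grid_pos (e + t * n) | t <- iota 0 k.+1].

(** The expected state of the algorithm once the labels 1, ..., i are placed. *)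
Definition grid_array (i : nat) : array :=
  [seq [seq x <- grid_col e | x <= i] | e <- es].

Lemma mem_grid e t : e \in es -> t <= k -> e + t * n \in grid.
Proof. by move=> ees letk; apply: (allpairs_f (fun e t => e + t * n)) => //; rewrite mem_iota. Qed.

Lemma gridP z : z \in grid -> exists e t, [/\ e \in es, t <= k & z = e + t * n].
Proof.
case/allpairsP => -[e t] [ees]; rewrite mem_iota add0n ltnS => letk ->.
by exists e, t.
Qed.

(** Reduction modulo n recovers e, since the elements of [es] are pairwise incongruent. *)
Lemma grid_inj e t e' t' : e \in es -> e' \in es ->
  e + t * n = e' + t' * n -> e = e' /\ t = t'.
Proof.
move=> ees e'es eqz; have ee' : e = e'.
  by apply: es_mod => //; rewrite -(modnMDl t) addnC eqz addnC modnMDl.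
split=> //; move: eqz; rewrite ee' => /addnI /eqP.
by rewrite eqn_pmul2r // => /eqP.
Qed.

Lemma grid_uniq : uniq grid.
Proof.
apply: allpairs_uniq; rewrite ?iota_uniq //.
  by move: sorted_es; rewrite ltn_sorted_uniq_leq => /andP[].
move=> [e t] [e' t'] /allpairsP[p [pes _ [-> ->]]] /allpairsP[p' [p'es _ [-> ->]]] /=.
by move/(grid_inj pes p'es) => [-> ->].
Qed.

Lemma size_grid : size grid = k.+1 * n.
Proof. by rewrite size_allpairs size_iota size_es mulnC. Qed.

Lemma leq_grid_pos z z' : z \in grid -> (grid_pos z <= grid_pos z') = (z <= z').
Proof. exact: leq_count_le. Qed.

Lemma grid_col_sorted e : e \in es -> sorted ltn (grid_col e).
Proof.
move=> ees; apply: (@homo_sorted_in _ _ (fun t => t <= k) _ ltn); last exact: iota_ltn_sorted.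
  move=> t t'; rewrite !unfold_in => letk let'k /= ltt'.
  by rewrite ltnNge leq_grid_pos ?mem_grid // leq_add2l leq_pmul2r // -ltnNge.
by apply/allP => t; rewrite mem_iota.
Qed.

Lemma mem_grid_col e e' t' : e \in es -> e' \in es -> t' <= k ->
  (grid_pos (e' + t' * n) \in grid_col e) = (e == e').
Proof.
move=> ees e'es let'; apply/mapP/eqP => [[t]|->].
  rewrite mem_iota add0n ltnS /= => letk /count_le_inj eqz.
  by case: (grid_inj e'es ees (eqz (mem_grid e'es let') (mem_grid ees letk))).
by exists t' => //; rewrite mem_iota.
Qed.

(** Labels increase down a column, so those at most i form an initial segment. The guard [j <= k]
    allows for a column that is already full. *)
Lemma grid_col_prefix e i : e \in es -> exists j,
  [/\ j <= k.+1, j <= k -> i < grid_pos (e + j * n),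
      forall t, t < j -> grid_pos (e + t * n) <= i &
      [seq x <- grid_col e | x <= i] = [seq grid_pos (e + t * n) | t <- iota 0 j]].
Proof.
move=> ees; exists (find (fun x => ~~ (x <= i)) (grid_col e)).
set j := find _ _.
have szc : size (grid_col e) = k.+1 by rewrite size_map size_iota.
have nthc t : t <= k -> nth 0 (grid_col e) t = grid_pos (e + t * n).
  by move=> letk; rewrite (nth_map 0) ?size_iota // nth_iota.
have lej : j <= k.+1 by rewrite -szc find_size.
have ltj t : t < j -> grid_pos (e + t * n) <= i.
  move=> ltt; have := before_find 0 ltt.
  by rewrite nthc; [move/negbFE|lia].
have gej : j <= k -> i < grid_pos (e + j * n).
  move=> lejk; rewrite -nthc // ltnNge; apply: (@nth_find _ 0 (fun x => ~~ (x <= i))).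
  by rewrite has_find szc.
split=> //.
have -> : [seq grid_pos (e + t * n) | t <- iota 0 j] = take j (grid_col e).
  by rewrite -map_take take_iota; congr map; congr iota; lia.
rewrite -{1}(cat_take_drop j (grid_col e)) filter_cat.
rewrite (_ : [seq x <- take _ _ | _] = take j (grid_col e)); last first.
  apply/all_filterP/(all_nthP 0) => t; rewrite size_take szc => ltt.
  have ltt' : t < j by move: ltt; case: ifP; lia.
  by rewrite nth_take // nthc ?ltj //; lia.
rewrite (_ : [seq x <- drop _ _ | _] = [::]) ?cats0 //.
apply/eqP; rewrite -size_eq0 size_filter -leqn0 leqNgt -has_count.
apply/hasPn => y /(nthP 0)[t]; rewrite size_drop szc nth_drop => ltt <-.
rewrite nthc -?ltnNge; last lia.
apply: leq_trans (gej _) _; first lia.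
by rewrite leq_grid_pos ?mem_grid //; [rewrite leq_add2l leq_mul2r leq_addr orbT|lia].
Qed.

Lemma grid_arrayS i : grid_array i.+1 =
  [seq if i.+1 \in grid_col e then rcons [seq x <- grid_col e | x <= i] i.+1
       else [seq x <- grid_col e | x <= i] | e <- es].
Proof. by apply/eq_in_map => e ees; rewrite filter_leS_sorted // grid_col_sorted. Qed.

(** As [es] is increasing, every column to the left of that of e has a smaller top label and is
    already nonempty; so the column of e is the leftmost empty one. *)
Lemma place_LetterS i e : e \in es -> grid_pos e = i.+1 ->
  place k (grid_array i) LetterS i.+1 = grid_array i.+1.
Proof.
move=> ees pose; rewrite grid_arrayS.
have ee0 : e = e + 0 * n by rewrite mul0n addn0.
have col_e e' : e' \in es -> (i.+1 \in grid_col e') = (e' == e).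
  by move=> e'es; rewrite -pose {1}ee0 mem_grid_col.
have nil_e : [seq x <- grid_col e | x <= i] = [::].
  have [[|j] [_ _ H ->]] // := grid_col_prefix i ees.
  by have := H 0 isT; rewrite -ee0 pose ltnn.
have cons_e e' : e' \in es -> e' < e -> [seq x <- grid_col e' | x <= i] != [::].
  move=> e'es lte; have [[|j] [_ H _ ->]] // := grid_col_prefix i e'es.
  have := H isT; rewrite mul0n addn0 -pose leq_grid_pos ?(leqNgt e) ?lte //.
  by rewrite ee0 mem_grid.
rewrite /place /grid_array; pose F e' := [seq x <- grid_col e' | x <= i].
transitivity [seq if e' == e then [:: i.+1] else F e' | e' <- es]; last first.
  by apply/eq_in_map => e' e'es; rewrite col_e //; case: eqVneq => [->|//]; rewrite nil_e.
rewrite -!/(F _) -/F; rewrite -/(F e) in nil_e.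
have {}cons_e e' : e' \in es -> e' < e -> F e' != [::] by apply: cons_e.
clearbody F; clear - sorted_es ees nil_e cons_e.
move: ees sorted_es cons_e => /splitPr[s1 s2].
rewrite (sorted_pairwise ltn_trans) pairwise_cat /= allrel_consr.
move=> /and3P[/andP[/allP lt1 _] _ /andP[/allP lt2 _]] cons_e.
rewrite !map_cat /= nil_e eqxx index_cat.
have -> : [::] \in [seq F e0 | e0 <- s1] = false.
  apply/negP => /mapP[e' e's1 /eqP]; rewrite eq_sym; apply/negP/cons_e.
    by rewrite mem_cat e's1.
  exact: lt1.
rewrite /= addn0 set_nth_cat_size.
congr (_ ++ _ :: _); apply/eq_in_map => e' e's.
  by have /= := lt1 _ e's; rewrite ltn_neqAle => /andP[/negbTE -> _].
by have /= := lt2 _ e's; rewrite ltn_neqAle eq_sym => /andP[/negbTE -> _].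
Qed.

(** The entry above the new one is the label of e + t n; it has to be the smallest active entry. *)
Lemma place_LetterW i e t : e \in es -> t < k -> grid_pos (e + t.+1 * n) = i.+1 ->
  place k (grid_array i) LetterW i.+1 = grid_array i.+1.
Proof.
move=> ees ltk pose; rewrite grid_arrayS /place.
have cole : [seq x <- grid_col e | x <= i] = [seq grid_pos (e + t * n) | t <- iota 0 t.+1].
  have [j [_ gej ltj ->]] := grid_col_prefix i ees; congr map; congr iota.
  apply/eqP; rewrite eqn_leq; apply/andP; split.
    by rewrite leqNgt; apply/negP => /ltj; rewrite pose ltnn.
  rewrite ltnNge; apply/negP => lejt.
  have := gej (leq_trans lejt (ltnW ltk)); rewrite -pose leq_grid_pos ?mem_grid //.
  by rewrite leq_add2l leq_pmul2r // ltnNge lejt.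
have last_e : last 0 [seq x <- grid_col e | x <= i] = grid_pos (e + t * n).
  by rewrite cole -addn1 iotaD map_cat last_cat.
have active_e : has_active k [seq x <- grid_col e | x <= i].
  by rewrite cole /has_active size_map size_iota.
(* The equality case in [?= iff] ensures that no other column is extended. *)
have activeP e' : e' \in es -> has_active k [seq x <- grid_col e' | x <= i] ->
    grid_pos (e + t * n) <= last 0 [seq x <- grid_col e' | x <= i] ?= iff (e' == e).
  move=> e'es; case: eqVneq => [-> _|nee']; first by rewrite last_e; split; rewrite ?leqnn ?eqxx.
  rewrite /has_active; have [[|j] [_ gej _ ->]] // := grid_col_prefix i e'es.
  rewrite size_map size_iota => /andP[_ ltjk].
  rewrite -[X in iota _ X]addn1 iotaD map_cat last_cat /= add0n.
  (* The next element of the column of e' is not yet placed, hence is at least e + (t + 1) n;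
     subtracting n compares the last placed elements. *)
  have := gej ltjk; rewrite -pose leq_grid_pos ?mem_grid // => lez.
  split; first by rewrite leq_grid_pos ?mem_grid ?(ltnW ltk) //; move: lez; rewrite !mulSn; lia.
  apply/negbTE/eqP => /count_le_inj H; move/eqP: nee'; apply.
  by case: (grid_inj ees e'es (H (mem_grid ees (ltnW ltk)) (mem_grid e'es (ltnW ltjk)))).
have smallest : smallest_active k (grid_array i) = grid_pos (e + t * n).
  apply: head_sort_min => [|y /mapP[c]].
    by rewrite -last_e; apply: map_f; rewrite mem_filter active_e; apply: map_f.
  rewrite mem_filter => /andP[ac /mapP[e' e'es eqc]] ->.
  by rewrite eqc; apply: (activeP e' e'es); rewrite -eqc.
rewrite -map_comp; apply/eq_in_map => e' e'es; rewrite [LHS]/comp.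
rewrite smallest -pose mem_grid_col //; case: (eqVneq e' e) => [->|nee'].
  by rewrite active_e last_e eqxx.
case: ifP => // /andP[/(activeP _ e'es) leif].
by rewrite eq_sym leif (negbTE nee').
Qed.

(** By induction on the label: a top element (t = 0) is placed by an S, any other one by a W. The
    length of D leaves exactly its last letter unread. *)
Lemma tableau_grid (D : seq step) :
  (forall i, i < k.+1 * n -> (nth East D i == North) = (i.+1 \in map grid_pos es)) ->
  size D = (k.+1 * n).+1 ->
  tableau k n D = [seq grid_col e | e <- es].
Proof.
move=> DN sizeD.
have placeE i : i < k.+1 * n ->
  place k (grid_array i) (nth LetterW (SW D) i) i.+1 = grid_array i.+1.
  move=> lti; have /count_le_surj : 0 < i.+1 <= size grid by rewrite size_grid.
  case=> [|z /gridP[e [[|t] [ees let_k ->]]] pose]; first exact: grid_uniq.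
    rewrite mul0n addn0 in pose.
    have : nth East D i == North.
      by rewrite DN // -pose; apply/mapP; exists e.
    rewrite /SW (nth_map East) ?sizeD 1?ltnW // => /eqP ->.
    exact: place_LetterS pose.
  have : (nth East D i == North) = false.
    rewrite DN // -pose; apply/negP => /mapP[e' e'es /count_le_inj H].
    have e'g : e' \in grid by rewrite -[e']addn0 -(mul0n n) mem_grid.
    have := H (mem_grid ees let_k) e'g.
    by rewrite -[e' in RHS]addn0 -(mul0n n) => /(grid_inj ees e'es) [].
  rewrite /SW (nth_map East) ?sizeD 1?ltnW //; case: (nth East D i) => // _.
  exact: place_LetterW pose.
have foldE j : j <= k.+1 * n ->
  foldl (fun T i => place k T (nth LetterW (SW D) i.-1) i) (grid_array 0) (iota 1 j) =
  grid_array j.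
  elim: j => // j IH ltj.
  by rewrite -[X in iota _ X]addn1 iotaD foldl_cat IH 1?ltnW //= add1n placeE.
have array0 : grid_array 0 = nseq n [::].
  rewrite -size_es -(size_map (fun e => [seq x <- grid_col e | x <= 0])).
  apply/all_pred1P/allP => c /mapP[e ees ->]; rewrite -[pred1 _ _]/(_ == _).
  rewrite -size_eq0 size_filter -leqn0 leqNgt -has_count; apply/hasPn => x.
  case/mapP => t; rewrite mem_iota => /= letk ->; rewrite -ltnNge -has_count.
  by apply/hasP; exists (e + t * n); rewrite ?mem_grid //=.
have arrayN : grid_array (k.+1 * n) = [seq grid_col e | e <- es].
  apply/eq_in_map => e ees; apply/all_filterP/allP => x /mapP[t _ ->].
  by rewrite -size_grid count_size.
have size_gt0 : 0 < k.+1 * n by rewrite muln_gt0.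
(* The algorithm starts with 1 already placed, so the state after label 1 must be identified: the
   least grid element e + t n is at least e, so label 1 is in the top row. *)
have [z zg pos1] : exists2 z, z \in grid & grid_pos z = 1.
  by apply: count_le_surj; rewrite ?grid_uniq ?size_grid.
have [e [t [ees letk eqz]]] := gridP zg.
have eg : e \in grid by rewrite -[e]addn0 -(mul0n n) mem_grid.
have pose : grid_pos e = 1.
  apply/eqP; rewrite eqn_leq -{1}pos1 leq_grid_pos // eqz leq_addr /= -has_count.
  by apply/hasP; exists e => /=.
have array1 : grid_array 1 = [:: 1] :: nseq n.-1 [::].
  by rewrite -(place_LetterS ees pose) array0; case: (n) n_gt0.
rewrite -arrayN -(foldE _ (leqnn _)) /tableau.
have -> : index_iota 2 (k * n + 1 + n) = iota 2 (k.+1 * n).-1.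
  by rewrite /index_iota; congr iota; rewrite mulSn; lia.
by rewrite -[X in iota 1 X](prednK size_gt0) /= placeE // array1.
Qed.

Lemma bottom_row_grid :
  bottom_row k [seq grid_col e | e <- es] = [seq grid_pos (e + k * n) | e <- es].
Proof.
have col_k e : onth (grid_col e) k = Some (grid_pos (e + k * n)).
  rewrite onthE (nth_map 0) ?size_map ?size_iota // (nth_map 0) ?size_iota //.
  by rewrite nth_iota.
rewrite /bottom_row; move: grid_col col_k => C CE.
by elim: (es) => //= e s ->; rewrite CE.
Qed.

End Filling.

(** * Counting the terms of arithmetic progressions of difference n *)

(* The number of t >= 0 with x + t n <= z; truncated subtraction gives 0 for z < x. *)
Definition hits (n z x : nat) := (z + n - x) %/ n.

Lemma hits_addn n z x : 0 < n -> hits n z x = (x <= z) + hits n z (x + n).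
Proof.
move=> n_gt0; rewrite /hits subnDr; case: leqP => [lexz|ltzx].
  by rewrite addnC -addnBA // divnDl ?dvdnn // divnn n_gt0.
by rewrite divn_small; [rewrite divn_small; lia|lia].
Qed.

(** Moving the start from x to x + 1 loses a term exactly when z itself lies on the progression from
    x. *)
Lemma hits_add1 n z x : 0 < n ->
  hits n z x = (x <= z) && (x == z %[mod n]) + hits n z x.+1.
Proof.
move=> n_gt0; rewrite /hits subnS; case: (leqP x z) => [lexz|ltzx] /=.
  have -> : z + n - x = (z + n - x).-1.+1 by lia.
  rewrite divnS //; congr (_ + _).
  have -> : (z + n - x).-1.+1 = z + n - x by lia.
  by rewrite -eqn_mod_dvd ?(leq_trans lexz) ?leq_addr // modnDr eq_sym.
by rewrite !divn_small; lia.
Qed.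

(** Each column is the progression from e with the tail from e + (k + 1) n removed; [hits_addn]
    telescopes along it. *)
Lemma count_grid k n es z : 0 < n ->
  grid_pos k n es z + \sum_(e <- es) hits n z (e + k.+1 * n) = \sum_(e <- es) hits n z e.
Proof.
move=> n_gt0; rewrite /grid_pos /grid; elim: es => [|e es IH]; first by rewrite !big_nil.
rewrite !big_cons (allpairs_cons (fun e t => e + t * n)) count_cat -IH addnACA; congr (_ + _).
elim: k.+1 => [|j IHj]; first by rewrite mul0n addn0.
rewrite -[X in iota _ X]addn1 iotaD map_cat count_cat /= addn0 -addnA add0n.
by rewrite -[RHS]IHj (@hits_addn n z (e + j * n)) // mulSn (addnC n) !addnA.
Qed.

(** * Ranks along a Dyck path and the telescoping count *)

Section Path.

Variables (n m : nat) (P : seq step).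
Hypothesis dyckP : dyck m n P.

(** Truncation never occurs at the vertices of a Dyck path, so this agrees with [rank]. *)
Definition nat_rank (i : nat) := (vertex P i).2 * m - (vertex P i).1 * n.

Lemma vertex_end : vertex P (size P) = (m, n).
Proof. by case/andP: dyckP => /eqP. Qed.

Lemma dyck_above i : i <= size P -> (vertex P i).1 * n <= (vertex P i).2 * m.
Proof. by case/andP: dyckP => _ /allP H leiP; apply: H; rewrite mem_iota. Qed.

Lemma rank_nat i : i <= size P -> rank m n (vertex P i) = (nat_rank i)%:Z%R.
Proof. by move=> /dyck_above H; rewrite /rank /nat_rank; lia. Qed.

Lemma vertexS i : i < size P -> vertex P i.+1 =
  if nth East P i == North then ((vertex P i).1, (vertex P i).2.+1)
  else ((vertex P i).1.+1, (vertex P i).2).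
Proof.
move=> ltiP; rewrite /vertex (take_nth East) // -cats1 !count_cat /=.
by case: (nth East P i) => /=; rewrite !addn0 addn1.
Qed.

Lemma vertex_sum i : i <= size P -> (vertex P i).1 + (vertex P i).2 = i.
Proof.
elim: i => [|i IH] lti; first by rewrite /vertex take0.
by rewrite vertexS //; case: ifP => _ /=; rewrite -{3}(IH (ltnW lti)) ?addnS ?addSn.
Qed.

Lemma size_dyck : size P = m + n.
Proof. by rewrite -[LHS](vertex_sum (leqnn _)) vertex_end. Qed.

Lemma vertex_mono i j : i <= j ->
  (vertex P i).1 <= (vertex P j).1 /\ (vertex P i).2 <= (vertex P j).2.
Proof.
move=> leij; rewrite /vertex /= -(subnKC leij) takeD !count_cat.
by split; apply: leq_addr.
Qed.

Lemma nat_rankS i : i < size P ->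
  if nth East P i == North then nat_rank i.+1 = nat_rank i + m
  else nat_rank i = nat_rank i.+1 + n.
Proof.
move=> ltiP; have := dyck_above ltiP; have := dyck_above (ltnW ltiP).
rewrite /nat_rank vertexS //; case: ifP => _ /=; rewrite ?mulSn; lia.
Qed.

Lemma nat_rank0 : nat_rank 0 = 0.
Proof. by rewrite /nat_rank /vertex take0. Qed.

Lemma nat_rank_end : nat_rank (size P) = 0.
Proof. by rewrite /nat_rank vertex_end /= mulnC subnn. Qed.

Definition ranks := [seq nat_rank i | i <- iota 0 (size P)].
(** Sorted, because the algorithm opens its columns from left to right in this order. *)
Definition north_ranks :=
  sort leq [seq nat_rank i | i <- iota 0 (size P) & nth East P i == North].

Lemma big_north_ranks (F : nat -> nat) : \sum_(e <- north_ranks) F e =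
  \sum_(0 <= i < size P | nth East P i == North) F (nat_rank i).
Proof.
rewrite (perm_big _ (permEl (perm_sort _ _))) /= big_map big_filter /index_iota.
by rewrite subn0.
Qed.

(* Summing [x <= z] = hits x - hits (x + n) over all vertices, the East steps
   cancel cyclically because they lower the rank by n. *)
Lemma count_ranks z : 0 < n ->
  count (leq^~ z) ranks + \sum_(e <- north_ranks) hits n z (e + m + n) =
  \sum_(e <- north_ranks) hits n z e.
Proof.
move=> n_gt0; rewrite !big_north_ranks; set H := hits n z.
have sumH : \sum_(0 <= i < size P) H (nat_rank i) =
    count (leq^~ z) ranks + \sum_(0 <= i < size P) H (nat_rank i + n).
  rewrite -sumn_count sumnE !big_map /index_iota subn0 -big_split /=.
  by apply: eq_bigr => i _; rewrite /H hits_addn.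
(* Split off the last or the first vertex from the sum over all vertices: both have rank 0. *)
have shiftH : \sum_(0 <= i < size P) H (nat_rank i + n) =
    \sum_(0 <= i < size P) H (nat_rank i.+1 + n).
  have := erefl (\sum_(0 <= i < (size P).+1) H (nat_rank i + n)).
  rewrite {1}big_nat_recr // big_nat_recl //= nat_rank0 nat_rank_end.
  by rewrite [RHS]addnC => /addIn.
move: sumH; rewrite shiftH (bigID (fun i => nth East P i == North)) /=.
rewrite [in RHS](bigID (fun i => nth East P i == North)) /= addnA.
rewrite [X in _ = _ + X](_ : _ = \sum_(0 <= i < size P | nth East P i != North) H (nat_rank i)).
  move/addIn => ->; congr (_ + _); rewrite big_nat_cond [RHS]big_nat_cond; apply: eq_bigr => i.
  by case/andP=> /andP[_ ltiP] Ni; have := nat_rankS ltiP; rewrite Ni => ->.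
rewrite big_nat_cond [RHS]big_nat_cond; apply: eq_bigr => i.
by case/andP=> /andP[_ ltiP] Ni; have := nat_rankS ltiP; rewrite (negbTE Ni) => ->.
Qed.

End Path.

(** * Incoming steps, and ranks when m = k n + 1 *)

(** The incoming steps form a cyclic shift of P. *)
Lemma perm_step_into (P : seq step) :
  perm_eq [seq step_into P i | i <- iota 0 (size P)] P.
Proof.
case/lastP: P => // s x; rewrite size_rcons /= last_rcons perm_sym perm_rcons perm_cons.
rewrite (iotaDl 1) -map_comp -{1}[s](mkseq_nth East) /mkseq.
have /eq_in_map -> // : {in iota 0 (size s), nth East s =1 step_into (rcons s x) \o addn 1}.
by move=> i; rewrite mem_iota /= => lti; rewrite nth_rcons lti.
Qed.

(** Serves at z = e + k n, where z + 1 = e + m is the rank at which a North step from e ends. *)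
Lemma count_leS (s : seq nat) (z : nat) : uniq s -> z.+1 \in s ->
  count (leq^~ z.+1) s = (count (leq^~ z) s).+1.
Proof.
move=> us zs; rewrite -[RHS]addn1; have <- : count_mem z.+1 s = 1 by rewrite count_uniq_mem ?zs.
elim: s {us zs} => //= y s ->; rewrite addnACA; congr (_ + _).
by rewrite leq_eqVlt ltnS; case: eqVneq => [->|]; rewrite ?ltnn ?addn0.
Qed.

Section FussPath.

Variables (k n : nat) (P : seq step).
Let m := k * n + 1.
Hypothesis n_gt0 : 0 < n.
Hypothesis dyckP : dyck m n P.

Local Notation rk := (nat_rank n m P).
Local Notation es := (north_ranks n m P).

(** Here m is 1 modulo n, and East steps change the rank by multiples of n. *)
Lemma nat_rank_mod i : i <= size P -> rk i = (vertex P i).2 %[mod n].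
Proof.
move=> /(dyck_above dyckP) above; rewrite -(modnMDl (vertex P i).1) addnC /nat_rank subnK //.
by rewrite mulnDr muln1 mulnA modnMDl.
Qed.

(** Equal ranks make the heights congruent modulo n. Equal heights give equal abscissas; otherwise
    the heights are 0 and n, the common rank is 0, and the later vertex would be the excluded
    endpoint. *)
Lemma nat_rank_inj i j : i < size P -> j < size P -> rk i = rk j -> i = j.
Proof.
wlog lt_ij : i j / i < j => [H|] lti ltj eqr.
  by case: (ltngtP i j) => // ltij; [apply: H|apply/esym/H].
have [_ ley] := vertex_mono P (ltnW lt_ij).
have leyn : (vertex P j).2 <= n.
  by have [_] := vertex_mono P (ltnW ltj); rewrite (vertex_end dyckP).
have := nat_rank_mod (ltnW ltj); rewrite -eqr nat_rank_mod ?(ltnW lti) // => /esym/eqP.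
have [si sj] := (vertex_sum (ltnW lti), vertex_sum (ltnW ltj)).
have [ai aj] := (dyck_above dyckP (ltnW lti), dyck_above dyckP (ltnW ltj)).
have szP := size_dyck dyckP.
rewrite eqn_mod_dvd //; case: (eqVneq (vertex P i).2 (vertex P j).2) => [eqy _|ney].
  move: eqr ai aj; rewrite /nat_rank eqy => eqr ai aj.
  have /eqP : (vertex P i).1 * n = (vertex P j).1 * n by lia.
  by rewrite eqn_pmul2r // => /eqP eqx; lia.
have lt_y : (vertex P i).2 < (vertex P j).2 by rewrite ltn_neqAle ney.
rewrite -subn_gt0 in lt_y; move/(dvdn_leq lt_y) => le_n.
have y_i0 : (vertex P i).2 = 0 by lia.
have y_jn : (vertex P j).2 = n by lia.
have x_i0 : (vertex P i).1 = 0 by move: ai; rewrite y_i0 mul0n leqn0 muln_eq0; lia.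
move: eqr; rewrite /nat_rank y_i0 x_i0 y_jn !mul0n subnn => /esym/eqP.
by rewrite subn_eq0 mulnC leq_pmul2r // => le_mx; lia.
Qed.

Lemma ranks_uniq : uniq (ranks n m P).
Proof.
rewrite map_inj_in_uniq ?iota_uniq // => i j; rewrite !mem_iota /= => lti ltj.
exact: nat_rank_inj.
Qed.

Lemma north_ranksP e :
  reflect (exists i, [/\ i < size P, nth East P i = North & e = rk i]) (e \in es).
Proof.
rewrite mem_sort; apply: (iffP mapP) => [[i]|[i [lti Ni ->]]].
  by rewrite mem_filter mem_iota => /andP[/eqP Ni lti] ->; exists i.
by exists i => //; rewrite mem_filter Ni mem_iota.
Qed.

Lemma north_ranks_sorted : sorted ltn es.
Proof.
rewrite ltn_sorted_uniq_leq sort_uniq sort_sorted ?andbT; last exact: leq_total.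
rewrite map_inj_in_uniq ?filter_uniq ?iota_uniq // => i j.
rewrite !mem_filter !mem_iota /= => /andP[_ lti] /andP[_ ltj].
exact: nat_rank_inj.
Qed.

Lemma size_north_ranks : size es = n.
Proof.
rewrite size_sort size_map size_filter -(count_map (nth East P) (pred1 North)).
rewrite -/(mkseq _ _) mkseq_nth.
by have := vertex_end dyckP; rewrite /vertex take_size => -[_].
Qed.

(** Modulo n the rank is the height, and North steps start at distinct heights below n. *)
Lemma north_ranks_mod : {in es &, forall e e', e = e' %[mod n] -> e = e'}.
Proof.
move=> e e' /north_ranksP[i [lti Ni ->]] /north_ranksP[j [ltj Nj ->]].
rewrite !nat_rank_mod ?(ltnW lti) ?(ltnW ltj) //.
have height l : l < size P -> nth East P l = North ->
    (vertex P l.+1).2 = (vertex P l).2.+1 by move=> ltl Nl; rewrite vertexS // Nl eqxx.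
have height_lt l : l < size P -> nth East P l = North -> (vertex P l).2 < n.
  move=> ltl Nl; have [_] := vertex_mono P ltl.
  by rewrite height // (vertex_end dyckP).
rewrite !modn_small ?height_lt // => eqy; congr rk.
have sep l l' : l' < size P -> nth East P l = North -> (vertex P l).2 = (vertex P l').2 ->
    ~ l < l'.
  move=> ltl' Nl eqyl ltll'; have [_] := vertex_mono P ltll'.
  by rewrite height ?(ltn_trans ltll') // eqyl ltnn.
by case: (ltngtP i j) => // /sep [].
Qed.

(** [count_ranks] and [count_grid] differ only in progressions starting at e + m + n and e + (k + 1)
    n, which are consecutive integers. By [hits_add1] the difference is an indicator that the
    hypothesis makes zero. *)
Lemma count_ranks_grid z :
  (forall e, e \in es -> e = z %[mod n] -> z < e + k.+1 * n) ->
  count (leq^~ z) (ranks n m P) = grid_pos k n es z.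
Proof.
move=> zP; have := count_grid k es z n_gt0; rewrite -(count_ranks dyckP z n_gt0).
rewrite [X in _ + X = _](_ : _ = \sum_(e <- es) hits n z (e + m + n)) => [/addIn //|].
rewrite big_seq [RHS]big_seq; apply: eq_bigr => e ees; rewrite hits_add1 //.
have -> : (e + k.+1 * n).+1 = e + m + n by rewrite /m mulSn; lia.
case: andP => // -[le /eqP]; rewrite addnC modnMDl => /(zP _ ees).
by rewrite ltnNge le.
Qed.

Lemma count_ranks_north e t : e \in es -> t <= k ->
  count (leq^~ (e + t * n)) (ranks n m P) = grid_pos k n es (e + t * n).
Proof.
move=> ees letk; apply: count_ranks_grid => e' e'es; rewrite addnC modnMDl.
move/(north_ranks_mod e'es ees) => ->; rewrite addnC ltn_add2l.
by rewrite ltn_pmul2r.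
Qed.

Lemma step_intoP i : i < size P ->
  reflect (exists2 e, e \in es & rk i = e + m) (step_into P i == North).
Proof.
move=> lti; apply: (iffP eqP) => [|[e /north_ranksP[j [ltj Nj ->]]]].
  case: i lti => [|i] /= lti Ni; last first.
    have := nat_rankS dyckP (ltnW lti); rewrite Ni => eqr.
    by exists (rk i) => //; apply/north_ranksP; exists i; split=> //; apply: ltnW.
  (* Vertex 0 stands for the endpoint. The last step cannot be North, as it would end at rank at
     least m > 0. *)
  have := @nat_rankS n m P dyckP (size P).-1; rewrite (prednK lti) leqnn => /(_ isT).
  by rewrite nth_last Ni eqxx (nat_rank_end dyckP) /m addnA addn1.
have := nat_rankS dyckP ltj; rewrite Nj eqxx => <-.
move: ltj; rewrite leq_eqVlt => /orP[/eqP eqj|ltj].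
  have := nat_rankS dyckP (_ : j < size P); rewrite -eqj leqnn Nj eqxx eqj.
  by rewrite (nat_rank_end dyckP) /m addnA addn1 => /(_ isT).
by move/(nat_rank_inj lti ltj) => ->.
Qed.

Lemma north_rank_add e : e \in es -> e + m \in ranks n m P.
Proof.
case/north_ranksP => j [ltj Nj ->]; have := nat_rankS dyckP ltj; rewrite Nj eqxx => <-.
move: (ltj); rewrite leq_eqVlt => /orP[/eqP ->|ltj']; last by apply: map_f; rewrite mem_iota.
(* The endpoint is not listed in [ranks], but vertex 0 is, with the same rank 0. *)
rewrite (nat_rank_end dyckP) -(nat_rank0 n m P); apply: map_f; rewrite mem_iota /=.
exact: leq_ltn_trans ltj.
Qed.

(** * The words [sweep] and [EN] read off from counts of ranks *)

Lemma size_rank_order : size (rank_order m n P) = size P.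
Proof. by rewrite size_sort size_iota. Qed.

Lemma mem_rank_order i : (i \in rank_order m n P) = (i < size P).
Proof. by rewrite mem_sort mem_iota. Qed.

Lemma rank_order_ranks : [seq rk i | i <- rank_order m n P] = sort leq (ranks n m P).
Proof.
apply: (sorted_eq leq_trans anti_leq); last first.
- by rewrite perm_sym perm_sort perm_sym; apply: perm_map; rewrite perm_sort.
- exact/sort_sorted/leq_total.
rewrite sorted_map.
have ltP : all (fun i => i < size P) (rank_order m n P).
  by apply/allP => i; rewrite mem_rank_order.
apply: (sub_in_sorted _ ltP); last by apply: sort_sorted => i j; apply: Order.TotalTheory.le_total.
move=> i j lti ltj.
by rewrite (rank_nat dyckP (ltnW lti)) (rank_nat dyckP (ltnW ltj)).
Qed.

Lemma count_ranks_nth p : p < size P ->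
  count (leq^~ (rk (nth 0 (rank_order m n P) p))) (ranks n m P) = p.+1.
Proof.
move=> ltp; have szr : size (ranks n m P) = size P by rewrite size_map size_iota.
rewrite -(nth_map 0 0 rk) ?size_rank_order // rank_order_ranks.
rewrite -(permP (permEl (perm_sort leq (ranks n m P)))) sorted_count_le_nth ?size_sort ?szr //.
by rewrite ltn_sorted_uniq_leq sort_uniq ranks_uniq sort_sorted //; apply: leq_total.
Qed.

(** The vertex at position p, counted from 0, has p + 1 ranks up to its own; on [es] this count
    equals the grid label ([count_ranks_north] with t = 0). *)
Lemma sweep_north p : p < size P ->
  (nth East (sweep m n P) p == North) = (p.+1 \in [seq grid_pos k n es e | e <- es]).
Proof.
move=> ltp; rewrite (nth_map 0) ?size_rank_order //.
have := count_ranks_nth ltp; have := mem_nth 0 (_ : p < size (rank_order m n P)).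
rewrite size_rank_order mem_rank_order => /(_ ltp).
move: (nth 0 _ p) => v ltv cntv.
have pos e : e \in es -> grid_pos k n es e = count (leq^~ e) (ranks n m P).
  by move=> ees; have := count_ranks_north ees (leq0n k); rewrite mul0n addn0.
apply/eqP/mapP => [Nv|[e /[dup] ees /north_ranksP[j [ltj Nj eqe]]]].
  have ves : rk v \in es by apply/north_ranksP; exists v.
  by exists (rk v) => //; rewrite pos.
rewrite pos // eqe -cntv => /count_le_inj eqr.
have rP i : i < size P -> rk i \in ranks n m P by move=> lti; apply: map_f; rewrite mem_iota.
by rewrite (nat_rank_inj ltv ltj (eqr (rP _ ltv) (rP _ ltj))).
Qed.

(** A North step from e ends at e + m, whose count is one more than the label of e + k n. The extra
    one is absorbed by p being counted from 0; it reappears as b + 1 when letters are numbered from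
    1. *)
Lemma EN_north p : p < size P -> (nth East (EN m n P) p == North) =
  (p \in [seq grid_pos k n es (e + k * n) | e <- es]).
Proof.
move=> ltp; rewrite (nth_map 0) ?size_rank_order //.
have := count_ranks_nth ltp; have := mem_nth 0 (_ : p < size (rank_order m n P)).
rewrite size_rank_order mem_rank_order => /(_ ltp).
move: (nth 0 _ p) => v ltv cntv.
have pos e : e \in es ->
    count (leq^~ (e + m)) (ranks n m P) = (grid_pos k n es (e + k * n)).+1.
  move=> ees; have em : e + m = (e + k * n).+1 by rewrite /m addn1 addnS.
  have := north_rank_add ees; rewrite em => mem_e.
  by rewrite count_leS ?ranks_uniq // count_ranks_north.
apply/(step_intoP ltv)/mapP => -[e ees].
  by move=> eqr; exists e => //; apply: succn_inj; rewrite -pos // -eqr.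
move=> eqp; exists e => //; apply: (@count_le_inj (ranks n m P)).
- by apply: map_f; rewrite mem_iota.
- exact: north_rank_add.
- by rewrite /= cntv pos // eqp.
Qed.

Lemma count_EN_East : count_mem East (EN m n P) = m.
Proof.
have -> : count_mem East (EN m n P) = count_mem East [seq step_into P i | i <- iota 0 (size P)].
  by apply/permP/perm_map; rewrite perm_sort.
rewrite (permP (perm_step_into P)).
by have := vertex_end dyckP; rewrite /vertex take_size => -[].
Qed.

Lemma bottom_row_tableau_sweep :
  bottom_row k (tableau k n (sweep m n P)) = [seq grid_pos k n es (e + k * n) | e <- es].
Proof.
have szP : size P = (k.+1 * n).+1 by rewrite (size_dyck dyckP) /m mulSn; lia.
rewrite (tableau_grid n_gt0 size_north_ranks north_ranks_sorted north_ranks_mod).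
- exact: bottom_row_grid.
- by move=> i lti; rewrite sweep_north // szP ltnW.
- by rewrite size_map size_rank_order.
Qed.

End FussPath.

Theorem theorem1p3 (k n m : nat) (hk : 1 <= k) (hn : 1 <= n)
    (hm : m = k * n + 1)
    (D : seq step) (hD : dyck m n D)
    (Dbar : seq step) (hDbar : dyck m n Dbar) (hsweep : sweep m n Dbar = D) :
  let x (i : nat) := nth East (EN m n Dbar) i.-1 in
  let b := bottom_row k (tableau k n D) in
  (forall i : nat, 1 <= i <= m + n ->
     (x i = North <-> i \in [seq bj + 1 | bj <- b]) /\
     (i \notin [seq bj + 1 | bj <- b] -> x i = East)) /\
  count_mem East (EN m n Dbar) = m.
Proof.
subst m D => x b; split; last exact: count_EN_East.
move=> i /andP[i_gt0 lei].
have xN : (x i == North) = (i \in [seq bj + 1 | bj <- b]).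
  rewrite /x /b bottom_row_tableau_sweep // EN_north ?(size_dyck hDbar) //; last first.
    by rewrite prednK.
  by rewrite -(mem_map succn_inj) prednK //; congr (_ \in _); apply: eq_map => j; rewrite addn1.
rewrite -xN; split; first by split => /eqP.
by case: (x i).
Qed.
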